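(* Let $n_1\geq n_2\geq n_3\geq 0$ be integers. Every achievable rate tuple $\mathbf{R}=(R_{12},R_{13},R_{21},R_{23},R_{31},R_{32})\in\mathbb{R}_+^6$ of the linear shift deterministic Y-channel DYC$(n_1,n_2,n_3)$ satisfies \begin{align*} R_{12}+R_{32}+R_{13}&\leq n_2,\\ R_{12}+R_{32}+R_{31}&\leq n_1,\\ R_{21}+R_{31}+R_{32}&\leq n_2,\\ R_{21}+R_{31}+R_{23}&\leq n_2,\\ R_{13}+R_{23}+R_{12}&\leq n_2,\\ R_{13}+R_{23}+R_{21}&\leq n_1. \end{align*}
   Context: The channel. $\mathbb{R}_+$ denotes the nonnegative reals. Let $n_1\ge n_2\ge n_3\ge 0$ be integers and $q=\max_j n_j=n_1$. Let $\mathbf{S}$ be the $q\times q$ down-shift matrix over $\mathbb{F}_2$, so that $\mathbf{S}^{m}$ shifts the entries of a vector down by $m$ positions, filling with zeros ($\mathbf{S}^0=I$). The linear shift deterministic Y-channel DYC$(n_1,n_2,n_3)$ has three users $1,2,3$ and a relay $r$, all full-duplex, with no direct links between users. At each time $i$, user $j$ sends $\mathbf{x}_{ji}\in\mathbb{F}_2^q$ and the relay sends $\mathbf{x}_{ri}\in\mathbb{F}_2^q$; the relay and user $j$ receive, respectively, $$\mathbf{y}_{ri}=\sum_{j=1}^3\mathbf{S}^{q-n_j}\mathbf{x}_{ji},\qquad \mathbf{y}_{ji}=\mathbf{S}^{q-n_j}\mathbf{x}_{ri},$$ with all operations over $\mathbb{F}_2$. Codes. Let $R_{jk}\in\mathbb{R}_+$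 for all distinct $j,k\in\{1,2,3\}$. User $j$ has a message $m_{jk}$ for user $k$, uniformly distributed over the set $\mathcal{M}_{jk}=\{1,\dots,2^{nR_{jk}}\}$; the six messages are independent. A code of length $n$ for the rate tuple $\mathbf{R}=(R_{12},R_{13},R_{21},R_{23},R_{31},R_{32})$ consists of these message sets; user encoders $\mathbf{x}_{ji}=f_{ji}(m_{jk},m_{jl},\mathbf{y}_{j1},\dots,\mathbf{y}_{j,i-1})$ for $\{j,k,l\}=\{1,2,3\}$ and $1\le i\le n$; relay encoders $\mathbf{x}_{ri}=f_{ri}(\mathbf{y}_{r1},\dots,\mathbf{y}_{r,i-1})$ for $1\le i\le n$; and decoders $(\hat m_{kj},\hat m_{lj})=g_j(\mathbf{y}_{j1},\dots,\mathbf{y}_{jn},m_{jk},m_{jl})$ for each user $j$. An error occurs if $(\hat m_{kj},\hat m_{lj})\ne(m_{kj},m_{lj})$ for some user $j$. Achievability. The rate tuple $\mathbf{R}$ is achievable if there exists a sequence of such codes for $\mathbf{R}$ whose average error probability can be made arbitrarily small by increasing $n$. *)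

(* Defs.v *)
From HB Require Import structures.
From mathcomp Require Import all_boot all_order all_algebra.
From mathcomp Require Import all_classical all_reals all_analysis.
Set Implicit Arguments.
Unset Strict Implicit.
Unset Printing Implicit Defensive.
Import Order.TTheory GRing.Theory Num.Theory.
Import numFieldNormedType.Exports.
Local Open Scope classical_set_scope.
Local Open Scope ring_scope.

Definition user1 : 'I_3 := @Ordinal 3 0 isT.
Definition user2 : 'I_3 := @Ordinal 3 1 isT.
Definition user3 : 'I_3 := @Ordinal 3 2 isT.

(* The six ordered pairs (source, destination) of distinct users.  Every
   quantity indexed by two users (rates, message set sizes) is a function on
   'I_3 * 'I_3 whose diagonal values are never used. *)
Definition user_pair := {p : 'I_3 * 'I_3 | p.1 != p.2}.
Definition src (p : user_pair) : 'I_3 := (val p).1.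
Definition dst (p : user_pair) : 'I_3 := (val p).2.
Definition mkpair (j k : 'I_3) (jk : j != k) : user_pair := exist _ (j, k) jk.

Section Channel.

Definition gains (n1 n2 n3 : nat) (j : 'I_3) : nat := tnth [tuple n1; n2; n3] j.

Variable g : 'I_3 -> nat.

Definition vlen : nat := \max_(j < 3) g j.

Definition vec := 'cV['F_2]_vlen.

(* Entry 0 is the top of a vector, so [down_shift *m x] has entry x_(i-1) in
   row i > 0, and 0 in row 0. *)
Definition down_shift : 'M['F_2]_vlen := \matrix_(i, j) (i == j.+1 :> nat)%:R.

Definition relay_output (x : 'I_3 -> vec) : vec :=
  \sum_(j < 3) down_shift ^+ (vlen - g j)%N *m x j.

Definition user_output (j : 'I_3) (xr : vec) : vec :=
  down_shift ^+ (vlen - g j)%N *m xr.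

Section Code.

(* M j k is the number of messages from user j to user k; the message set
   {1, ..., M j k} is represented by 'I_(M j k). *)
Variable M : 'I_3 -> 'I_3 -> nat.

Definition messages := {dffun forall p : user_pair, 'I_(M (src p) (dst p))}.

Definition sent (j : 'I_3) := forall k : 'I_3, j != k -> 'I_(M j k).
Definition wanted (j : 'I_3) := forall k : 'I_3, k != j -> 'I_(M k j).

Definition sent_by (m : messages) (j : 'I_3) : sent j :=
  fun k jk => m (mkpair jk).
Arguments sent_by : clear implicits.

(* An encoder maps the list of past outputs to the next input: applied to a
   list of size i - 1 it is the encoding function of time i. *)
Record code := Code {
  user_enc : forall j : 'I_3, sent j -> seq vec -> vec;
  relay_enc : seq vec -> vec;
  user_dec : forall j : 'I_3, seq vec -> sent j -> wanted j
}.

Arguments user_enc : clear implicits.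
Arguments user_dec : clear implicits.

Variable c : code.

(* The outputs received up to time i, in chronological order, by the relay and
   by each user. *)
Fixpoint outputs (m : messages) (i : nat) : seq vec * ('I_3 -> seq vec) :=
  if i is i'.+1 then
    let: (yr, y) := outputs m i' in
    (rcons yr (relay_output (fun j => user_enc c j (sent_by m j) (y j))),
     fun j => rcons (y j) (user_output j (relay_enc c yr)))
  else ([::], fun=> [::]).

Definition decoded (n : nat) (m : messages) (j : 'I_3) : wanted j :=
  user_dec c j ((outputs m n).2 j) (sent_by m j).

Arguments decoded : clear implicits.

Definition error (n : nat) (m : messages) : bool :=
  [exists p : user_pair, decoded n m (dst p) (src p) (valP p) != m p].

(* The six messages are independent and uniform, i.e., the message tuple is
   uniform on [messages]. *)
Definition error_prob (K : realType) (n : nat) : K :=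
  #|[pred m : messages | error n m]|%:R / #|{: messages}|%:R.

End Code.

Section Achievable.

Variables (K : realType) (R : 'I_3 -> 'I_3 -> K).

(* 2^(nR) need not be an integer: the messages are the integers between 1 and
   2^(nR). *)
Definition nb_messages (n : nat) (j k : 'I_3) : nat :=
  Num.truncn (2 `^ (n%:R * R j k)).

Definition achievable : Prop :=
  exists C : forall n : nat, code (nb_messages n),
    error_prob (C n) K n @[n --> \oo] --> (0 : K).

End Achievable.

End Channel.

(* Main.v *)
(* No entropy is needed: fix a code and distinct users j, k, l, and count the
   message tuples decoded without error.  With m_jk and m_jl, the output y_j
   gives m_kj and m_lj; if m_lk and y_l are known too, user j can imitate the
   decoder of user l and gets m_kl.  Hence M_kj M_lj M_kl is at most about the
   number of values of the pair (y_j, y_l) for fixed m_jk, m_jl, m_lk.  This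
   number is at most 2^(nd) both for d = max(n_j, n_l), since the stronger of
   the two outputs determines the other, and for d = max(n_k, n_l), since user
   j's contribution to y_r is a function of m_jk, m_jl and the past of y_r, so
   that y_r is determined by the superposition of the inputs of k and l. *)
Require Import Defs.
From HB Require Import structures.
From mathcomp Require Import all_boot all_order all_algebra.
From mathcomp Require Import all_classical all_reals all_analysis.
From mathcomp Require Import ring lra.
Set Implicit Arguments.
Unset Strict Implicit.
Unset Printing Implicit Defensive.
Import Order.TTheory GRing.Theory Num.Theory.
Import numFieldNormedType.Exports.
Local Open Scope classical_set_scope.
Local Open Scope ring_scope.

Lemma ord3_cover (j k l : 'I_3) : j != k -> j != l -> k != l ->
  forall i, [|| i == j, i == k | i == l].
Proof.
by case: j k l => [[|[|[|?]]] ?] // [[|[|[|?]]] ?] // [[|[|[|?]]] ?] //= _ _ _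
  [[|[|[|?]]] ?].
Qed.

Section Channel.
Variable g : 'I_3 -> nat.

Local Notation vlen := (vlen g).
Local Notation vec := (vec g).
Local Notation S := (down_shift g).

Lemma gain_le_vlen (j : 'I_3) : (g j <= vlen)%N.
Proof. exact: leq_bigmax. Qed.

(** * Vectors whose top entries vanish *)

Definition headless (h : nat) (v : vec) :=
  forall i : 'I_vlen, (i < h)%N -> v i 0 = 0.

Lemma headless_shift (h : nat) (x : vec) : headless h (S ^+ h *m x).
Proof.
elim: h => // h IHh i ih.
rewrite exprS -mulmxE -mulmxA mxE big1 // => j _.
rewrite mxE; case: eqP => [ij|_]; last by rewrite mul0r.
by rewrite IHh ?mulr0 // -ltnS -ij.
Qed.

(** The target has exactly 2^d elements, which is what the counting needs. The default 0 is reached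
    only when [d] exceeds [vlen]. *)
Definition low (d : nat) (v : vec) : 'cV['F_2]_d :=
  \col_i (if insub (vlen - d + i)%N is Some i' then v i' 0 else 0).

Lemma low_inj (d : nat) (v w : vec) :
  headless (vlen - d) v -> headless (vlen - d) w -> low d v = low d w -> v = w.
Proof.
move=> v0 w0 /colP eq_vw; apply/colP => i.
have [ih|hi] := ltnP i (vlen - d)%N; first by rewrite v0 ?w0.
have id : (i - (vlen - d) < d)%N.
  by rewrite ltn_subLR // (leq_trans (ltn_ord i)) // addnC -leq_subLR.
by have := eq_vw (Ordinal id); rewrite !mxE /= subnKC // valK.
Qed.

Section Code.
Variables (M : 'I_3 -> 'I_3 -> nat) (c : Defs.code g M) (n : nat).

Local Notation messages := (messages M).
Local Notation sent_by m j := (@Defs.sent_by M m j).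

(** * Counting correctly decoded message tuples *)

Lemma messages_eq (m m' : messages) :
  (forall j, sent_by m j = sent_by m' j) -> m = m'.
Proof.
move=> eq_sent; apply/ffunP => -[[a b] /= ab].
exact: (congr1 (fun s : sent M a => s b ab) (eq_sent a)).
Qed.

Lemma sent_by_eq (m m' : messages) (j k l : 'I_3) (jk : j != k) (jl : j != l) :
  k != l -> m (mkpair jk) = m' (mkpair jk) -> m (mkpair jl) = m' (mkpair jl) ->
  sent_by m j = sent_by m' j.
Proof.
move=> kl eq_k eq_l; apply: functional_extensionality_dep => i.
apply: functional_extensionality_dep => ji.
have /or3P[/eqP ij|/eqP ik|/eqP il] := ord3_cover jk jl kl i.
- by case/eqP: ji.
- by subst i; rewrite /Defs.sent_by (bool_irrelevance ji jk).
- by subst i; rewrite /Defs.sent_by (bool_irrelevance ji jl).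
Qed.

Lemma decoded_correct (m : messages) (j k : 'I_3) (kj : k != j) :
  ~~ error c n m -> decoded c n m kj = m (mkpair kj).
Proof.
move/existsPn/(_ (mkpair kj)); rewrite negbK => /eqP <-.
by rewrite (bool_irrelevance (valP (mkpair kj)) kj).
Qed.

Lemma decoded_eq (m m' : messages) (j k : 'I_3) (kj : k != j) :
  ~~ error c n m -> ~~ error c n m' ->
  (outputs c m n).2 j = (outputs c m' n).2 j ->
  sent_by m j = sent_by m' j -> m (mkpair kj) = m' (mkpair kj).
Proof.
move=> cm cm' eq_y eq_s.
by rewrite -!decoded_correct // /decoded eq_y eq_s.
Qed.

(** The factors are grouped as the counting uses them: first the three messages recovered by
    decoding, then the three given as side information. *)
Lemma card_messages (j k l : 'I_3) : j != k -> j != l -> k != l ->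
  #|{: messages}| =
  ((M k j * M l j * M k l) * (M j k * M j l * M l k))%N.
Proof.
move=> jk jl kl.
have cover := ord3_cover jk jl kl.
have prod3 (G : 'I_3 -> nat) : (\prod_i G i = G j * G k * G l)%N.
  rewrite (bigD1 j) //= (bigD1 k) 1?eq_sym //= (bigD1 l) /=; last first.
    by rewrite !(eq_sym l) jl kl.
  rewrite big1 ?muln1 ?mulnA // => i.
  by have := cover i; case: eqP; case: eqP; case: eqP.
have -> : #|{: messages}| = (\prod_(p : user_pair) M (src p) (dst p))%N.
  rewrite card_dep_ffun foldrE big_map big_enum /=.
  by apply: eq_bigr => p _; rewrite card_ord.
have -> : (\prod_(p : user_pair) M (src p) (dst p) =
    \prod_a \prod_(b | a != b) M a b)%N.
  rewrite pair_big_dep /=.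
  exact: (esym (big_sub [pred p : 'I_3 * 'I_3 | p.1 != p.2]
    (fun p => M p.1 p.2))).
rewrite prod3 !(big_mkcond (fun b => _ != b)) !prod3 !eqxx /=.
rewrite (eq_sym k j) (eq_sym l j) (eq_sym l k) jk jl kl /=; ring.
Qed.

Lemma card_correct (T : finType) (F : messages -> T) (j k l : 'I_3) :
  j != k -> j != l -> k != l ->
  (forall m m', F m = F m' -> sent_by m j = sent_by m' j ->
     (outputs c m n).2 j = (outputs c m' n).2 j /\
     (outputs c m n).2 l = (outputs c m' n).2 l) ->
  (#|[pred m : messages | ~~ error c n m]| * (M k j * M l j * M k l)
    <= #|T| * #|{: messages}|)%N.
Proof.
move=> jk jl kl F_det.
have mul_le (a b t s : nat) : (a <= t * s -> a * b <= t * (b * s))%N.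
  by move=> a_le; rewrite mulnCA mulnC leq_mul2l a_le orbT.
rewrite (card_messages jk jl kl); apply: mul_le.
have kj : k != j by rewrite eq_sym.
have lj : l != j by rewrite eq_sym.
have lk : l != k by rewrite eq_sym.
pose G (m : messages) := (F m, (m (mkpair jk), m (mkpair jl), m (mkpair lk))).
have G_inj : {in [pred m : messages | ~~ error c n m] &, injective G}.
  move=> m m'; rewrite !inE => cm cm' [eqF eq_jk eq_jl eq_lk].
  have eq_j := sent_by_eq kl eq_jk eq_jl.
  have [eq_yj eq_yl] := F_det _ _ eqF eq_j.
  have eq_kj := decoded_eq kj cm cm' eq_yj eq_j.
  have eq_lj := decoded_eq lj cm cm' eq_yj eq_j.
  (* User l's messages are m_lj, just decoded by user j, and m_lk, which is given: user j can now
     run the decoder of user l. *)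
  have eq_l := sent_by_eq jk eq_lj eq_lk.
  have eq_kl := decoded_eq kl cm cm' eq_yl eq_l.
  have eq_k := sent_by_eq jl eq_kj eq_kl.
  apply: messages_eq => i.
  by have /or3P[/eqP->|/eqP->|/eqP->] := ord3_cover jk jl kl i.
rewrite -(card_in_imset G_inj).
by apply: leq_trans (max_card _) _; rewrite !card_prod !card_ord.
Qed.

Lemma card_low_seq (d : nat) :
  #|{: {ffun 'I_n -> 'cV['F_2]_d}}| = (2 ^ (d * n))%N.
Proof. by rewrite card_ffun card_mx card_Fp // muln1 card_ord expnM. Qed.

Lemma card_correct_ge (K : realType) :
  0 < #|{: messages}|%:R :> K -> error_prob c K n < 2^-1 ->
  #|{: messages}|%:R <= 2 * #|[pred m : messages | ~~ error c n m]|%:R :> K.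
Proof.
move=> T_gt0; rewrite /error_prob ltr_pdivrMr // => err_lt.
have := cardC [pred m : messages | error c n m].
move/(congr1 (fun i => i%:R : K)); rewrite natrD => tE.
have {}tE : #|[pred m : messages | error c n m]|%:R +
    #|[pred m : messages | ~~ error c n m]|%:R = #|{: messages}|%:R :> K.
  exact: tE.
lra.
Qed.

(** * Observations that determine the outputs *)

Definition relay_input (m : messages) (i : nat) : vec :=
  relay_enc c (outputs c m i).1.

Definition user_input (m : messages) (i : nat) (j : 'I_3) : vec :=
  user_enc c (sent_by m j) ((outputs c m i).2 j).

Lemma outputsS (m : messages) (i : nat) : outputs c m i.+1 =
  (rcons (outputs c m i).1 (relay_output (user_input m i)),
   fun j => rcons ((outputs c m i).2 j) (user_output j (relay_input m i))).
Proof. by rewrite /= /relay_input /user_input; case: (outputs c m i). Qed.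

Definition downlink_obs (d : nat) (m : messages) : {ffun 'I_n -> 'cV['F_2]_d} :=
  [ffun i : 'I_n => low d (S ^+ (vlen - d) *m relay_input m i)].

(** The observation is what a receiver of gain [d] would see; the weaker user [u] sees the same
    vector shifted down by [d - g u] further positions. *)
Lemma downlink_obs_det (d : nat) (m m' : messages) (u : 'I_3) :
  (g u <= d)%N -> (d <= vlen)%N -> downlink_obs d m = downlink_obs d m' ->
  (outputs c m n).2 u = (outputs c m' n).2 u.
Proof.
move=> ud dq /ffunP eq_obs.
have outE (x : vec) : user_output u x = S ^+ (d - g u) *m (S ^+ (vlen - d) *m x).
  by rewrite mulmxA mulmxE -exprD addnC addnBA // subnK.
suff: forall i, (i <= n)%N -> (outputs c m i).2 u = (outputs c m' i).2 u.
  exact.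
elim=> // i IHi lt_in; rewrite !outputsS /= IHi 1?ltnW // !outE.
congr (rcons _ (_ *m _)).
have := eq_obs (Ordinal lt_in); rewrite !ffunE /=.
by apply: low_inj; apply: headless_shift.
Qed.

Definition relay_output_but (j : 'I_3) (x : 'I_3 -> vec) : vec :=
  \sum_(u < 3 | u != j) S ^+ (vlen - g u) *m x u.

Definition uplink_obs (j : 'I_3) (d : nat) (m : messages) :
    {ffun 'I_n -> 'cV['F_2]_d} :=
  [ffun i : 'I_n => low d (relay_output_but j (user_input m i))].

Lemma headless_relay_output_but (j : 'I_3) (d : nat) (x : 'I_3 -> vec) :
  (forall u, u != j -> (g u <= d)%N) ->
  headless (vlen - d) (relay_output_but j x).
Proof.
move=> gd i id; rewrite /relay_output_but summxE big1 // => u uj.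
by apply: headless_shift; apply: leq_trans id _; rewrite leq_sub2l // gd.
Qed.

(** By induction on time: equal past outputs fix the relay input, hence all new user outputs, and
    also the input of user [j], whose contribution is added to the observed sum to give the new
    relay output. *)
Lemma uplink_obs_det (j : 'I_3) (d : nat) (m m' : messages) :
  (forall u, u != j -> (g u <= d)%N) ->
  uplink_obs j d m = uplink_obs j d m' -> sent_by m j = sent_by m' j ->
  outputs c m n = outputs c m' n.
Proof.
move=> gd /ffunP eq_obs eq_j.
suff: forall i, (i <= n)%N -> outputs c m i = outputs c m' i by exact.
elim=> // i IHi lt_in; rewrite !outputsS.
have eq_i := IHi (ltnW lt_in); rewrite /relay_input eq_i.
congr (rcons _ _, _); rewrite /relay_output !(bigD1 (P := xpredT) j) //=.
rewrite {1 3}/user_input eq_i eq_j; congr (_ + _).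
have := eq_obs (Ordinal lt_in); rewrite !ffunE /=.
by apply: low_inj; apply: headless_relay_output_but.
Qed.

Lemma downlink_card (j k l : 'I_3) : j != k -> j != l -> k != l ->
  (#|[pred m : messages | ~~ error c n m]| * (M k j * M l j * M k l)
    <= 2 ^ (maxn (g j) (g l) * n) * #|{: messages}|)%N.
Proof.
move=> jk jl kl; rewrite -card_low_seq.
apply: (card_correct (F := downlink_obs _)) => // m m' eq_obs _.
have dq : (maxn (g j) (g l) <= vlen)%N by rewrite geq_max !gain_le_vlen.
by split; apply: downlink_obs_det eq_obs; rewrite // ?leq_maxl ?leq_maxr.
Qed.

Lemma uplink_card (j k l : 'I_3) : j != k -> j != l -> k != l ->
  (#|[pred m : messages | ~~ error c n m]| * (M k j * M l j * M k l)
    <= 2 ^ (maxn (g k) (g l) * n) * #|{: messages}|)%N.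
Proof.
move=> jk jl kl; rewrite -card_low_seq.
apply: (card_correct (F := uplink_obs j _)) => // m m' eq_obs eq_j.
suff -> : outputs c m n = outputs c m' n by [].
apply: uplink_obs_det eq_obs eq_j => u uj.
have := ord3_cover jk jl kl u; rewrite (negPf uj) /=.
by case/orP=> /eqP->; rewrite ?leq_maxl ?leq_maxr.
Qed.

End Code.

(** * From cardinalities to rates *)

Section Rates.
Variables (K : realType) (R : 'I_3 -> 'I_3 -> K).
Hypothesis R_ge0 : forall j k : 'I_3, j != k -> 0 <= R j k.

Lemma exp_rate_ge1 (n : nat) (j k : 'I_3) : j != k ->
  1 <= 2 `^ (n%:R * R j k) :> K.
Proof.
by move=> jk; rewrite -[leLHS](powRr0 2) ler_powR ?ler1n // mulr_ge0 ?R_ge0.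
Qed.

Lemma nb_messages_gt0 (n : nat) (j k : 'I_3) : j != k ->
  (0 < nb_messages R n j k)%N.
Proof. by move=> jk; rewrite truncn_gt0 exp_rate_ge1. Qed.

(** Rounding down costs at most a factor 2: 2^(nR) < M + 1 <= 2M, since M >= 1. *)
Lemma nb_messages_ge (n : nat) (j k : 'I_3) : j != k ->
  2 `^ (n%:R * R j k) <= 2 * (nb_messages R n j k)%:R :> K.
Proof.
move=> jk; have := nb_messages_gt0 n jk; rewrite -(ler1n K).
have := truncnS_gt (2 `^ (n%:R * R j k)); rewrite -natr1 -/(nb_messages R n j k).
lra.
Qed.

Lemma rate_bound (d : nat) (j k l : 'I_3) : j != k -> j != l -> k != l ->
  achievable g R ->
  (forall n (c : Defs.code g (nb_messages R n)),
     (#|[pred m : messages _ | ~~ error c n m]| *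
       (nb_messages R n k j * nb_messages R n l j * nb_messages R n k l)
     <= 2 ^ (d * n) * #|{: messages (nb_messages R n)}|)%N) ->
  R k j + R l j + R k l <= d%:R.
Proof.
move=> jk jl kl [C C0] card_le; rewrite leNgt; apply/negP => gap.
have kj : k != j by rewrite eq_sym.
have lj : l != j by rewrite eq_sym.
set delta := R k j + R l j + R k l - d%:R.
have delta_gt0 : 0 < delta by rewrite subr_gt0.
have ev_err : \forall n \near \oo, error_prob (C n) K n < 2^-1.
  by apply: cvgr_lt C0 _ _; rewrite invr_gt0.
(* The 5 yields a gap of 2^5 = 8 * 4: the 8 absorbs the rounding of three message numbers, and the 4
   exceeds the 2 lost by having only half of the tuples decoded correctly. *)
have ev_big : \forall n \near \oo, 5 / delta <= n%:R :> K.
  exact: nbhs_infty_ger.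
have [n [err_n big_n]] : exists n,
    error_prob (C n) K n < 2^-1 /\ 5 / delta <= n%:R :> K.
  by near \oo => n; exists n; split; near: n.
have mess_gt0 : 0 < #|{: messages (nb_messages R n)}|%:R :> K.
  rewrite ltr0n (card_messages _ jk jl kl) !muln_gt0 !nb_messages_gt0 //.
  by rewrite eq_sym.
have half : #|{: messages (nb_messages R n)}|%:R <=
    2 * #|[pred m : messages _ | ~~ error (C n) n m]|%:R :> K.
  exact: card_correct_ge.
have := card_le n (C n); rewrite -(ler_nat K) !natrM natrX.
move: (nb_messages_ge n kj) (nb_messages_ge n lj) (nb_messages_ge n kl).
set x := (nb_messages R n k j)%:R; set y := (nb_messages R n l j)%:R.
set z := (nb_messages R n k l)%:R => xP yP zP.
move: mess_gt0 half; set t := #|_|%:R; set s := #|_|%:R => t_gt0 half le_s.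
have pow_ge0 r : 0 <= 2 `^ r :> K by exact: powR_ge0.
have xyzP : 2 `^ (n%:R * (R k j + R l j + R k l)) <= 8 * (x * y * z).
  rewrite !mulrDr !powRD ?pnatr_eq0 ?implybT //.
  have -> : 8 * (x * y * z) = (2 * x) * (2 * y) * (2 * z) by ring.
  by rewrite !ler_pM ?mulr_ge0.
have gapP : 32 * 2 ^+ (d * n) <= 2 `^ (n%:R * (R k j + R l j + R k l)) :> K.
  have -> : 32 = 2 ^+ 5 :> K by rewrite -natrX.
  rewrite -exprD -powR_mulrn // ler_powR ?ler1n // natrD natrM.
  have : 5 <= n%:R * delta by rewrite -ler_pdivrMr.
  by rewrite /delta; lra.
set D := 2 ^+ (d * n) in le_s gapP.
have D_gt0 : 0 < D by rewrite exprn_gt0.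
have : t * (4 * D) <= 2 * s * (x * y * z).
  by apply: ler_pM => //; lra.
have := mulr_gt0 D_gt0 t_gt0; lra.
Unshelve. all: by end_near.
Qed.

End Rates.

Lemma downlink_bound (K : realType) (R : 'I_3 -> 'I_3 -> K) (j k l : 'I_3) :
  (forall j k : 'I_3, j != k -> 0 <= R j k) -> achievable g R ->
  j != k -> j != l -> k != l ->
  R k j + R l j + R k l <= (maxn (g j) (g l))%:R.
Proof.
move=> R_ge0 R_ach jk jl kl; apply: rate_bound => // n c; exact: downlink_card.
Qed.

Lemma uplink_bound (K : realType) (R : 'I_3 -> 'I_3 -> K) (j k l : 'I_3) :
  (forall j k : 'I_3, j != k -> 0 <= R j k) -> achievable g R ->
  j != k -> j != l -> k != l ->
  R k j + R l j + R k l <= (maxn (g k) (g l))%:R.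
Proof.
move=> R_ge0 R_ach jk jl kl; apply: rate_bound => // n c; exact: uplink_card.
Qed.

End Channel.

Theorem theorem1 (K : realType) (n1 n2 n3 : nat) (R : 'I_3 -> 'I_3 -> K)
    (n21 : (n2 <= n1)%N) (n32 : (n3 <= n2)%N)
    (R_ge0 : forall j k : 'I_3, j != k -> 0 <= R j k)
    (R_ach : achievable (gains n1 n2 n3) R) :
  R user1 user2 + R user3 user2 + R user1 user3 <= n2%:R /\
  R user1 user2 + R user3 user2 + R user3 user1 <= n1%:R /\
  R user2 user1 + R user3 user1 + R user3 user2 <= n2%:R /\
  R user2 user1 + R user3 user1 + R user2 user3 <= n2%:R /\
  R user1 user3 + R user2 user3 + R user1 user2 <= n2%:R /\
  R user1 user3 + R user2 user3 + R user2 user1 <= n1%:R.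
Proof.
have down := downlink_bound (g := gains n1 n2 n3) R_ge0 R_ach.
have up := uplink_bound (g := gains n1 n2 n3) R_ge0 R_ach.
have g1 : gains n1 n2 n3 user1 = n1 by [].
have g2 : gains n1 n2 n3 user2 = n2 by [].
have g3 : gains n1 n2 n3 user3 = n3 by [].
(* One instance per inequality, in the order of the conclusion; the digits are j, k, l. For j = 1
   the downlink would only give n1, so the third and fourth bounds come from the uplink of users 2
   and 3. *)
have D213 := down user2 user1 user3 isT isT isT.
have D231 := down user2 user3 user1 isT isT isT.
have U132 := up user1 user3 user2 isT isT isT.
have U123 := up user1 user2 user3 isT isT isT.
have D312 := down user3 user1 user2 isT isT isT.
have D321 := down user3 user2 user1 isT isT isT.
move: D213 D231 U132 U123 D312 D321; rewrite g1 g2 g3.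
rewrite (maxn_idPl n32) (maxn_idPr n32) (maxn_idPr n21).
rewrite (maxn_idPr (leq_trans n32 n21)) => *.
by do ![split]; lra.
Qed.
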